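(* Let $n\ge1$ and $v,w\in\mathfrak{S}_n$. For $J\subseteq\mathrm{GDes}(v)$ let $C_J(v,w)$ be the set of $\zeta\in\mathfrak{S}_n$ with $\mathrm{Des}(\zeta)\subseteq J$ such that: (i) $v_J\zeta^{-1}\le w$; (ii) if $v'\in\mathfrak{S}_n$, $v\le v'$ and $v'_J\zeta^{-1}\le w$, then $v'=v$; (iii) if $R$ is a set with $\mathrm{Des}(\zeta)\subseteq R\subseteq J$ and $v_R\zeta^{-1}\le w$, then $R=J$. Let $\kappa(v,w)=\#C_{\mathrm{GDes}(v)}(v,w)$. Then the antipode $S$ of $\mathfrak{S}Sym$ satisfies $$S(\mathcal{M}_v)=(-1)^{\#\mathrm{GDes}(v)+1}\sum_{w\in\mathfrak{S}_n}\kappa(v,w)\,\mathcal{M}_w .$$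
   Context: Permutations in one-line notation, product is composition. $\mathrm{Des}(x)=\{p\in[n-1]:x_p>x_{p+1}\}$; $\mathrm{GDes}(x)=\{p\in[n-1]: x_i>x_j \text{ for all } i\le p<j\}$. $\mathrm{st}(a_1,\ldots,a_m)\in\mathfrak{S}_m$ is the permutation with the same relative order as the distinct integers $a_i$. For $x\in\mathfrak{S}_a,y\in\mathfrak{S}_b$, $x\times y\in\mathfrak{S}_{a+b}$ has $(x\times y)(i)=x_i$ ($i\le a$), $(x\times y)(a+j)=a+y_j$. For $v\in\mathfrak{S}_n$, $J=\{p_1<\cdots<p_k\}\subseteq[n-1]$: $v_J=\mathrm{st}(v_1..v_{p_1})\times\mathrm{st}(v_{p_1+1}..v_{p_2})\times\cdots\times\mathrm{st}(v_{p_k+1}..v_n)$, $v_\emptyset=v$. Weak order: $u\le v$ iff $\mathrm{Inv}(u)\subseteq\mathrm{Inv}(v)$, $\mathrm{Inv}(u)=\{(i,j):i<j,u_i>u_j\}$, Möbius function $\mu$. $\mathfrak{S}Sym$ is the graded connected Hopf algebra over $\mathbb{Q}$ with basis $\{\mathcal{F}_u\}$, product $\mathcal{F}_u\cdot\mathcal{F}_v=\sum_{\zeta}\mathcal{F}_{(u\times v)\zeta^{-1}}$ over $\zeta\in\mathfrak{S}_{p+q}$ increasing on $[1,p]$ and on $[p+1,p+q]$, coproduct $\Delta(\mathcal{F}_u)=\sum_{p=0}^n\mathcal{F}_{\mathrm{st}(u_1..u_p)}\otimes\mathcal{F}_{\mathrm{st}(u_{p+1}..u_n)}$. Monomial basis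 $\mathcal{M}_u=\sum_{v\ge u}\mu(u,v)\mathcal{F}_v$. *)

(* Defs.v *)
(* Permutations of [n] are encoded in one-line notation as
   sequences of naturals, 0-based: a permutation of S_n is a seq that is a
   rearrangement of [:: 0; 1; ...; n-1].  Descent positions are kept 1-based
   (p in [1, n-1] means "between entries p and p+1"), as in the paper. *)
From mathcomp Require Import all_boot all_order all_algebra.
Set Implicit Arguments. Unset Strict Implicit. Unset Printing Implicit Defensive.
Import Order.TTheory GRing.Theory Num.Theory.
Local Open Scope ring_scope.

Definition allperms (n : nat) : seq (seq nat) := permutations (iota 0 n).
Definition is_perm (n : nat) (s : seq nat) : bool := perm_eq s (iota 0 n).

Definition permcomp (u v : seq nat) : seq nat := map (fun i => nth 0%N u i) v.
Definition pinv (v : seq nat) : seq nat := map (fun i => index i v) (iota 0 (size v)).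

Definition st (s : seq nat) : seq nat :=
  map (fun x => count (fun y => (y < x)%N) s) s.

Definition cross (x y : seq nat) : seq nat := x ++ map (addn (size x)) y.

Definition Des (x : seq nat) : seq nat :=
  [seq p <- iota 1 (size x).-1 | (nth 0 x p < nth 0 x p.-1)%N].
Definition GDes (x : seq nat) : seq nat :=
  [seq p <- iota 1 (size x).-1 |
    all (fun i => all (fun j => (nth 0 x j < nth 0 x i)%N) (iota p (size x - p)))
        (iota 0 p)].

Definition vJ (v : seq nat) (J : seq nat) : seq nat :=
  let cuts := 0%N :: sort leq (undup J) ++ [:: size v] in
  foldr cross [::]
    [seq st (take (ab.2 - ab.1) (drop ab.1 v)) | ab <- zip cuts (behead cuts)].

Definition weak_le (u v : seq nat) : bool :=
  (size u == size v) &&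
  all (fun i => all (fun j => (nth 0 u j < nth 0 u i)%N ==> (nth 0 v j < nth 0 v i)%N)
                    (iota i.+1 (size u - i.+1)))
      (iota 0 (size u)).

Definition ninv (v : seq nat) : nat :=
  \sum_(i <- iota 0 (size v))
     count (fun j => (nth 0 v j < nth 0 v i)%N) (iota i.+1 (size v - i.+1)).

(* Möbius function of the weak order on S_n, by the standard recursion
   mu(u,u) = 1, mu(u,v) = - sum_{u <= z < v} mu(u,z) for u < v, 0 otherwise;
   the fuel (ninv v).+1 is always sufficient. *)
Fixpoint mob_fuel (k : nat) (u v : seq nat) : rat :=
  match k with
  | 0%N => (u == v)%:R
  | k'.+1 =>
    if u == v then 1 else
    if weak_le u v then
      - \sum_(z <- allperms (size v) | weak_le u z && weak_le z v && (z != v)) mob_fuel k' u z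
    else 0
  end.
Definition mobius (u v : seq nat) : rat := mob_fuel (ninv v).+1 u v.

(* Elements of SSym: finite formal Q-linear combinations of basis elements F_u *)
Definition eltSS := seq (rat * seq nat).
Definition coefSS (x : eltSS) (w : seq nat) : rat := \sum_(a <- x | a.2 == w) a.1.
Definition eqElt (x y : eltSS) : Prop := forall w, coefSS x w = coefSS y w.
Definition scaleSS (c : rat) (x : eltSS) : eltSS := [seq (c * a.1, a.2) | a <- x].
Definition FF (u : seq nat) : eltSS := [:: (1, u)].

Definition shuffle_ok (p : nat) (z : seq nat) : bool :=
  sorted ltn (take p z) && sorted ltn (drop p z).
Definition prodF (u v : seq nat) : seq (seq nat) :=
  [seq permcomp (cross u v) (pinv z) |
     z <- allperms (size u + size v) & shuffle_ok (size u) z].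
Definition mulSS (x y : eltSS) : eltSS :=
  flatten [seq [seq (a.1 * b.1, z) | z <- prodF a.2 b.2] | a <- x, b <- y].

Definition extSS (S : seq nat -> eltSS) (x : eltSS) : eltSS :=
  flatten [seq scaleSS a.1 (S a.2) | a <- x].

(* counit times unit: epsilon(F_u) 1 *)
Definition unitSS (u : seq nat) : eltSS := if size u == 0%N then FF [::] else [::].

(* S is an antipode of SSym: m (S (x) id) Delta = m (id (x) S) Delta = eta epsilon,
   checked on the basis F_u, u in S_n, all n *)
Definition is_antipode (S : seq nat -> eltSS) : Prop :=
  forall u : seq nat, is_perm (size u) u ->
    eqElt (flatten [seq mulSS (S (st (take p u))) (FF (st (drop p u))) | p <- iota 0 (size u).+1])
        (unitSS u) /\
    eqElt (flatten [seq mulSS (FF (st (take p u))) (S (st (drop p u))) | p <- iota 0 (size u).+1])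
        (unitSS u).

Definition MM (u : seq nat) : eltSS :=
  [seq (mobius u z, z) | z <- allperms (size u) & weak_le u z].

Fixpoint subseqs (s : seq nat) : seq (seq nat) :=
  match s with
  | [::] => [:: [::]]
  | x :: s' => let r := subseqs s' in map (cons x) r ++ r
  end.

Definition subsetb (A B : seq nat) : bool := all (fun a => a \in B) A.

Definition inC (J v w zeta : seq nat) : bool :=
  let n := size v in
  [&& subsetb (Des zeta) J,
      weak_le (permcomp (vJ v J) (pinv zeta)) w,
      all (fun v' => (weak_le v v' && weak_le (permcomp (vJ v' J) (pinv zeta)) w) ==> (v' == v))
          (allperms n)
    & all (fun R => (subsetb (Des zeta) R && weak_le (permcomp (vJ v R) (pinv zeta)) w)
                      ==> (perm_eq R J))
          (subseqs J)].

Definition kappa (v w : seq nat) : nat :=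
  count (inC (GDes v) v w) (allperms (size v)).

(* Main.v *)
(** If [Des zeta] is contained in [J], the inversions of [v_J zeta^-1] are those of [zeta^-1] together with the images
    under [zeta] of the inversions of [v] inside the blocks of [J].  Hence
    [v_J zeta^-1 <= w] holds iff [zeta^-1 <= w] and [v <= g], where [g] has its
    [J]-blocks in decreasing order and each block ordered like [w zeta].

    The antipode recursion gives Takeuchi's formula: [S(F_u)] is the sum of
    [(-1)^(#J + 1) F_(u_J zeta^-1)] over all [J] and all [zeta] with [Des zeta]
    contained in [J].  Since [F_x] is the sum of the [M_w] with [x <= w], the
    coefficient of [M_w] in [S(M_v)] is a signed sum over [J] and [zeta] of
    [sum_(v <= u <= g) mu(v, u)], that is of the indicator of [v = g].  For fixed
    [zeta], the [J] with [v = g] are subsets of [GDes v] closed under supersets in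
    [GDes v] and under intersections, so they form an interval [[R, GDes v]] and
    their signs cancel unless [R = GDes v], which is condition (iii). *)
Require Import Defs.
From mathcomp Require Import all_boot all_order all_algebra.
From mathcomp Require Import zify.
Set Implicit Arguments. Unset Strict Implicit. Unset Printing Implicit Defensive.
Import GRing.Theory.
Local Open Scope ring_scope.

Local Notation nt := (nth 0%N).

Section Standardization.
Local Open Scope nat_scope.
Implicit Types (s u v x y z : seq nat) (n : nat).

Lemma is_permP n s : is_perm n s -> [/\ size s = n, uniq s & s =i iota 0 n].
Proof.
move=> h; split; first by rewrite (perm_size h) size_iota.
  by rewrite (perm_uniq h) iota_uniq.
exact: perm_mem h.
Qed.

Lemma is_perm_uniq n s : size s = n -> uniq s -> (forall i, i < n -> nt s i < n) ->
  is_perm n s.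
Proof.
move=> ss us lts.
have sub : {subset s <= iota 0 n}.
  by move=> a /(nthP 0) [i]; rewrite ss => hi <-; rewrite mem_iota add0n lts.
apply: uniq_perm => //; first exact: iota_uniq.
by have [] := uniq_min_size us sub; first by rewrite size_iota ss.
Qed.

Lemma is_perm_size n s : is_perm n s -> size s = n.
Proof. by case/is_permP. Qed.

Lemma is_perm_lt n s i : is_perm n s -> i < n -> nt s i < n.
Proof.
case/is_permP=> ss _ ms hi; have : nt s i \in s by rewrite mem_nth ?ss.
by rewrite ms mem_iota.
Qed.

Lemma is_perm_mem n s i : is_perm n s -> (i \in s) = (i < n).
Proof. by case/is_permP=> _ _ ->; rewrite mem_iota. Qed.

Lemma is_perm_inj n s i j : is_perm n s -> i < n -> j < n ->
  (nt s i == nt s j) = (i == j).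
Proof. by case/is_permP=> ss us _ hi hj; rewrite nth_uniq ?ss. Qed.

Lemma mem_allperms n s : (s \in allperms n) = is_perm n s.
Proof. by rewrite mem_permutations. Qed.

Lemma allperms_uniq n : uniq (allperms n).
Proof. exact: permutations_uniq. Qed.

Lemma size_st s : size (st s) = size s.
Proof. by rewrite size_map. Qed.

Lemma nth_st s i : i < size s ->
  nt (st s) i = count (fun k => nt s k < nt s i) (iota 0 (size s)).
Proof.
move=> hi; rewrite (nth_map 0) //.
by rewrite -[X in count _ X = _](mkseq_nth 0 s) /mkseq count_map.
Qed.

Lemma count_lt_sub (T : eqType) (a b : pred T) (s : seq T) (x : T) :
  {in s, forall y : T, a y -> b y} -> x \in s -> b x -> ~~ a x -> count a s < count b s.
Proof.
move=> sub xs bx nax.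
rewrite (_ : count b s = count a s + count (predD b a) s).
  by rewrite -[X in X < _]addn0 ltn_add2l -has_count; apply/hasP; exists x => //=; rewrite nax.
rewrite -count_predUI (_ : count (predI _ _) s = 0) ?addn0.
  apply: eq_in_count => y ys /=; have := sub y ys.
  by case: (a y) => //= ->.
by apply/eqP; rewrite -leqn0 leqNgt -has_count; apply/hasPn => y _ /=; case: (a y).
Qed.

Lemma st_lt s i j : i < size s -> j < size s -> (nt (st s) i < nt (st s) j) = (nt s i < nt s j).
Proof.
move=> hi hj; rewrite !nth_st //.
have mono k l : k < size s -> l < size s -> nt s k <= nt s l ->
  count (fun r => nt s r < nt s k) (iota 0 (size s)) <=
  count (fun r => nt s r < nt s l) (iota 0 (size s)).
  by move=> hk hl hkl; apply: sub_count => r /= /leq_trans; apply.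
case: (ltnP (nt s i) (nt s j)) => h.
  apply: (@count_lt_sub _ _ _ _ i); rewrite ?mem_iota ?ltnn //.
  by move=> r _ /= hr; apply: ltn_trans h.
by apply/negbTE; rewrite -leqNgt mono.
Qed.

Lemma st_perm s : uniq s -> is_perm (size s) (st s).
Proof.
move=> us; apply: is_perm_uniq; first exact: size_st.
  apply/(uniqP 0) => i j; rewrite !inE size_st => hi hj e.
  have := st_lt hi hj; have := st_lt hj hi; rewrite e ltnn => h1 h2.
  by apply/eqP; rewrite -(nth_uniq 0 hi hj us) eqn_leq leqNgt -h1 leqNgt -h2.
move=> i hi; rewrite nth_st //.
rewrite -{2}(size_iota 0 (size s)) -(count_predT (iota 0 _)).
by apply: (@count_lt_sub _ _ _ _ i); rewrite ?mem_iota ?ltnn.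
Qed.

Lemma eq_st u v : size u = size v ->
  (forall i j, i < size u -> j < size u -> (nt u i < nt u j) = (nt v i < nt v j)) ->
  st u = st v.
Proof.
move=> suv h; apply: (@eq_from_nth _ 0); rewrite !size_st // => i hi.
rewrite !nth_st -?suv //; apply: eq_in_count => k.
by rewrite mem_iota => hk; apply: h.
Qed.

Lemma st_id n s : is_perm n s -> st s = s.
Proof.
move=> h; have [ss us ms] := is_permP h.
rewrite /st -[RHS]map_id; apply/eq_in_map => x; rewrite ms mem_iota /= => hx.
rewrite (permP h) -size_filter -{2}(size_iota 0 x); congr size.
have -> : n = x + (n - x) by lia.
rewrite iotaD filter_cat add0n (eq_in_filter (a2 := predT)); last first.
  by move=> y; rewrite mem_iota => /= ->.
rewrite filter_predT (eq_in_filter (a2 := pred0)) ?filter_pred0 ?cats0 // => y.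
by rewrite mem_iota /=; lia.
Qed.

Lemma perm_ltn_total n s i j : is_perm n s -> i < n -> j < n -> i != j ->
  (nt s i < nt s j) = ~~ (nt s j < nt s i).
Proof.
by move=> h hi hj; rewrite -(is_perm_inj h) // => d; rewrite -leqNgt ltn_neqAle d.
Qed.

Lemma perm_order_eq n u v : is_perm n u -> is_perm n v ->
  (forall a b, a < b -> b < n -> (nt u b < nt u a) = (nt v b < nt v a)) -> u = v.
Proof.
move=> hu hv h; rewrite -(st_id hu) -(st_id hv); apply: eq_st.
  by rewrite !(@is_perm_size n).
move=> i j; rewrite (is_perm_size hu) => hi hj.
case: (ltngtP i j) => [ij|ji|->]; last by rewrite !ltnn.
  have nij : i != j by rewrite neq_ltn ij.
  by rewrite (perm_ltn_total hu hi hj nij) (perm_ltn_total hv hi hj nij) h.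
exact: h.
Qed.

End Standardization.

Section WeakOrder.
Local Open Scope nat_scope.
Implicit Types (s u v x y z : seq nat) (n : nat).

Lemma weak_leP n u v : size u = n -> size v = n ->
  reflect (forall a b, a < b -> b < n -> nt u b < nt u a -> nt v b < nt v a) (weak_le u v).
Proof.
move=> su sv; rewrite /weak_le su sv eqxx /=.
apply: (iffP allP) => [h a b ab bn|h a].
  have /h/allP : a \in iota 0 n by rewrite mem_iota; lia.
  by move=> /(_ b); rewrite mem_iota => /(_ ltac:(lia))/implyP.
rewrite mem_iota => an; apply/allP => b; rewrite mem_iota => bn.
by apply/implyP; apply: h; lia.
Qed.

Lemma weak_le_refl n u : is_perm n u -> weak_le u u.
Proof. by move/is_perm_size => su; apply/(weak_leP su su). Qed.

Lemma weak_le_trans n v u w : is_perm n u -> is_perm n v -> is_perm n w ->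
  weak_le u v -> weak_le v w -> weak_le u w.
Proof.
move=> /is_perm_size su /is_perm_size sv /is_perm_size sw.
move=> /(weak_leP su sv) uv /(weak_leP sv sw) vw.
by apply/(weak_leP su sw) => a b ab bn /(uv _ _ ab bn)/(vw _ _ ab bn).
Qed.

Lemma weak_le_anti n u v : is_perm n u -> is_perm n v ->
  weak_le u v -> weak_le v u -> u = v.
Proof.
move=> hu hv; have [su sv] := (is_perm_size hu, is_perm_size hv).
move=> /(weak_leP su sv) uv /(weak_leP sv su) vu.
by apply: (perm_order_eq hu hv) => a b ab bn; apply/idP/idP; [apply: uv|apply: vu].
Qed.

Lemma ninvE v : ninv v = count (fun ij => nt v ij.2 < nt v ij.1)
  [seq (i, j) | i <- iota 0 (size v), j <- iota i.+1 (size v - i.+1)].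
Proof.
rewrite count_flatten sumnE !big_map; apply: eq_bigr => i _.
by rewrite count_map.
Qed.

Lemma ninv_lt n u v : is_perm n u -> is_perm n v -> weak_le u v -> u != v ->
  ninv u < ninv v.
Proof.
move=> hu hv luv nuv; have [su sv] := (is_perm_size hu, is_perm_size hv).
have /(weak_leP su sv) uv := luv.
have mem a b : ((a, b) \in [seq (i, j) | i <- iota 0 n, j <- iota i.+1 (n - i.+1)])
  = (a < b < n).
  apply/allpairsPdep/idP => [[i [j]]|h].
    by rewrite !mem_iota => -[? ? [-> ->]]; lia.
  by exists a, b; rewrite !mem_iota; split => //; lia.
have : ~~ all (fun ab => (nt v ab.2 < nt v ab.1) ==> (nt u ab.2 < nt u ab.1))
   [seq (i, j) | i <- iota 0 n, j <- iota i.+1 (n - i.+1)].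
  apply: contra nuv => /allP h; apply/eqP/(perm_order_eq hu hv) => a b ab bn.
  apply/idP/idP; first exact: uv.
  by have /h/implyP : (a, b) \in [seq (i, j) | i <- iota 0 n, j <- iota i.+1 (n - i.+1)]
    by rewrite mem ab.
move=> /allPn [[a b] abs]; rewrite negb_imply /= => /andP [vba uba].
rewrite !ninvE su sv; apply: count_lt_sub abs vba uba => -[i j].
by rewrite mem => /andP [ij jn]; apply: uv.
Qed.

End WeakOrder.

Lemma bigD1_seq_cond (R : nmodType) (I : eqType) (s : seq I) (P : pred I) (F : I -> R) (j : I) :
  j \in s -> uniq s -> P j ->
  \sum_(i <- s | P i) F i = F j + \sum_(i <- s | P i && (i != j)) F i.
Proof.
move=> js us Pj; rewrite -big_filter (bigD1_seq j) ?mem_filter ?Pj ?filter_uniq //.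
by rewrite big_filter_cond.
Qed.

Section Moebius.
Variable n : nat.
Implicit Types (u v w x z : seq nat).

Lemma mob_fuel_stable k k' u v : is_perm n v -> (ninv v < k)%N -> (ninv v < k')%N ->
  mob_fuel k u v = mob_fuel k' u v.
Proof.
elim: k k' v => // k IH [//|k'] v hv lk lk' /=.
case: eqP => // _; case: ifP => // _; congr (- _).
rewrite (is_perm_size hv); rewrite big_seq_cond [RHS]big_seq_cond; apply: eq_bigr => z.
rewrite mem_allperms => /and3P [hz /andP [_ zv] nzv].
have lt := ninv_lt hz hv zv nzv.
by apply: IH => //; lia.
Qed.

Lemma mobius_sum u g : is_perm n u -> is_perm n g ->
  \sum_(z <- allperms n | weak_le u z && weak_le z g) mobius u z = (u == g)%:R.
Proof.
move=> hu hg; case: (boolP (weak_le u g)) => ug; last first.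
  rewrite big_seq_cond big_pred0; last first.
    move=> z; rewrite mem_allperms; apply/and3P => -[hz uz zg].
    by rewrite (weak_le_trans hu hz hg uz zg) in ug.
  by case: eqP => // e; rewrite e (weak_le_refl hg) in ug.
rewrite (@bigD1_seq_cond _ _ _ _ _ g) ?mem_allperms ?allperms_uniq ?ug ?(weak_le_refl hg) //=.
case: eqP => [<-|/eqP nug].
  rewrite big_seq_cond big_pred0; last first.
    move=> z; rewrite mem_allperms; apply/and3P => -[hz /andP [uz zu] /eqP].
    by apply; apply: (weak_le_anti hz hu zu uz).
  by rewrite addr0 /mobius /= eqxx.
rewrite {1}/mobius /= (negbTE nug) ug (is_perm_size hg).
apply/eqP; rewrite addrC subr_eq0; apply/eqP.
rewrite big_seq_cond [RHS]big_seq_cond; apply: eq_bigr => z.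
rewrite mem_allperms => /and3P [hz /andP [_ zg] nzg].
by apply: (mob_fuel_stable _ hz) => //; apply: (ninv_lt hz hg zg nzg).
Qed.

Lemma weak_le_triangular (L R : seq nat -> rat) :
  (forall w, is_perm n w -> \sum_(x <- allperms n | weak_le x w) L x =
                            \sum_(x <- allperms n | weak_le x w) R x) ->
  forall x, is_perm n x -> L x = R x.
Proof.
move=> h x; have [k] := ubnP (ninv x); elim: k x => // k IH x lk hx.
have := h x hx.
rewrite (@bigD1_seq_cond _ _ _ _ _ x) ?mem_allperms ?allperms_uniq ?(weak_le_refl hx) //=.
rewrite [RHS](@bigD1_seq_cond _ _ _ _ _ x) ?mem_allperms ?allperms_uniq ?(weak_le_refl hx) //=.
have -> : \sum_(i <- allperms n | weak_le i x && (i != x)) L i =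
          \sum_(i <- allperms n | weak_le i x && (i != x)) R i.
  rewrite big_seq_cond [RHS]big_seq_cond; apply: eq_bigr => z.
  rewrite mem_allperms => /and3P [hz zx nzx].
  by apply: IH => //; have := ninv_lt hz hx zx nzx; lia.
by move/addIr.
Qed.

End Moebius.

Section Composition.
Local Open Scope nat_scope.
Implicit Types (s u v x y z : seq nat) (n : nat).

Lemma nth_permcomp u v i : i < size v -> nt (permcomp u v) i = nt u (nt v i).
Proof. by move=> hi; rewrite (nth_map 0). Qed.

Lemma size_pinv v : size (pinv v) = size v.
Proof. by rewrite size_map size_iota. Qed.

Lemma nth_pinv v i : i < size v -> nt (pinv v) i = index i v.
Proof. by move=> hi; rewrite (nth_map 0) ?size_iota // nth_iota. Qed.

Lemma nth_pinvK n v i : is_perm n v -> i < n -> nt (pinv v) (nt v i) = i.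
Proof.
move=> hv hi; have [sv uv _] := is_permP hv.
by rewrite nth_pinv ?sv ?(is_perm_lt hv) // index_uniq ?sv.
Qed.

Lemma nth_pinvKV n v i : is_perm n v -> i < n -> nt v (nt (pinv v) i) = i.
Proof.
move=> hv hi; have [sv uv _] := is_permP hv.
by rewrite nth_pinv ?sv // nth_index // (is_perm_mem _ hv).
Qed.

Lemma permcomp_perm n u v : is_perm n u -> is_perm n v -> is_perm n (permcomp u v).
Proof.
move=> hu hv; have [su uu _] := is_permP hu; have [sv uv _] := is_permP hv.
apply: is_perm_uniq; first by rewrite size_map.
  apply/(uniqP 0) => i j; rewrite !inE size_map sv => hi hj.
  rewrite !nth_permcomp ?sv // => /eqP.
  by rewrite !(is_perm_inj hu, is_perm_inj hv) ?(is_perm_lt hv) // => /eqP.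
by move=> i hi; rewrite nth_permcomp ?sv // !(is_perm_lt hu, is_perm_lt hv).
Qed.

Lemma pinv_perm n v : is_perm n v -> is_perm n (pinv v).
Proof.
move=> hv; have [sv uv _] := is_permP hv.
apply: is_perm_uniq; first by rewrite size_pinv.
  apply/(uniqP 0) => i j; rewrite !inE size_pinv sv => hi hj e.
  by rewrite -(nth_pinvKV hv hi) e (nth_pinvKV hv hj).
by move=> i hi; rewrite nth_pinv ?sv // -sv index_mem (is_perm_mem _ hv).
Qed.

Lemma permcomp_pinvK n x y : is_perm n x -> is_perm n y ->
  permcomp y (pinv (permcomp (pinv x) y)) = x.
Proof.
move=> hx hy; have hz := permcomp_perm (pinv_perm hx) hy.
set z := permcomp _ _ in hz *.
apply: (@eq_from_nth _ 0).
  by rewrite size_map (is_perm_size (pinv_perm hz)) (is_perm_size hx).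
move=> i; rewrite size_map (is_perm_size (pinv_perm hz)) => hi.
rewrite nth_permcomp ?(is_perm_size (pinv_perm hz)) //.
have hj : nt (pinv z) i < n by rewrite (is_perm_lt (pinv_perm hz)).
have e : nt (pinv x) (nt y (nt (pinv z) i)) = i.
  by rewrite -[RHS](nth_pinvKV hz hi) nth_permcomp ?(is_perm_size hy).
by rewrite -[in RHS]e (nth_pinvKV hx) ?(is_perm_lt hy).
Qed.

Lemma pinv_permcompK n y z : is_perm n y -> is_perm n z ->
  permcomp (pinv (permcomp y (pinv z))) y = z.
Proof.
move=> hy hz; have hx := permcomp_perm hy (pinv_perm hz).
set x := permcomp _ _ in hx *.
apply: (@eq_from_nth _ 0).
  by rewrite size_map (is_perm_size hy) (is_perm_size hz).
move=> i; rewrite size_map (is_perm_size hy) => hi.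
rewrite nth_permcomp ?(is_perm_size hy) //.
have hzi : nt z i < n by rewrite (is_perm_lt hz).
have <- : nt x (nt z i) = nt y i.
  by rewrite nth_permcomp ?(is_perm_size (pinv_perm hz)) // (nth_pinvK hz).
by rewrite (nth_pinvK hx).
Qed.

Lemma perm_permcomp_pinv n y : is_perm n y ->
  perm_eq [seq permcomp y (pinv z) | z <- allperms n] (allperms n).
Proof.
move=> hy; apply: uniq_perm; last 1 first.
- move=> x; rewrite mem_allperms; apply/mapP/idP => [[z]|hx].
    by rewrite mem_allperms => hz ->; apply: permcomp_perm => //; apply: pinv_perm.
  exists (permcomp (pinv x) y); last by rewrite (permcomp_pinvK hx hy).
  by rewrite mem_allperms; apply: permcomp_perm => //; apply: pinv_perm.
- rewrite map_inj_in_uniq ?allperms_uniq // => z z'; rewrite !mem_allperms => hz hz' e.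
  by rewrite -(pinv_permcompK hy hz) e (pinv_permcompK hy hz').
exact: allperms_uniq.
Qed.

End Composition.

Section Blocks.
Local Open Scope nat_scope.
Implicit Types (s u v w x y z J : seq nat) (n : nat).

Definition separated J a b := has (fun p => a < p <= b) J.

Lemma nth_cross x y i : i < size x + size y ->
  nt (cross x y) i = if i < size x then nt x i else size x + nt y (i - size x).
Proof.
move=> hi; rewrite nth_cat; case: ltnP => // h.
by rewrite (nth_map 0) //; lia.
Qed.

Lemma cross_perm p q x y : is_perm p x -> is_perm q y -> is_perm (p + q) (cross x y).
Proof.
move=> hx hy; rewrite /is_perm iotaD; apply: perm_cat => //.
by rewrite add0n (is_perm_size hx) -[X in iota X _]addn0 iotaDl; apply: perm_map.
Qed.

Lemma cross_lt p q x y a b : is_perm p x -> is_perm q y -> a < b -> b < p + q ->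
  (nt (cross x y) b < nt (cross x y) a) =
  if b < p then nt x b < nt x a
  else if a < p then false else nt y (b - p) < nt y (a - p).
Proof.
move=> hx hy ab bn; rewrite !nth_cross ?(is_perm_size hx) ?(is_perm_size hy) //; last by lia.
case: (ltnP b p) => bp; first by rewrite (ltn_trans ab bp).
case: (ltnP a p) => ap; last by rewrite ltn_add2l.
by have := is_perm_lt hx ap; lia.
Qed.

Definition blocks c s v :=
  foldr cross [::] [seq st (take (ab.2 - ab.1) (drop ab.1 v)) | ab <- zip (c :: s) s].

Lemma blocksP c s v : uniq v -> path ltn c s -> last c s <= size v ->
  is_perm (last c s - c) (blocks c s v) /\
  forall a b, a < b -> b < last c s - c ->
    (nt (blocks c s v) b < nt (blocks c s v) a) =
    ~~ separated s (c + a) (c + b) && (nt v (c + b) < nt v (c + a)).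
Proof.
move=> uv; elim: s c => [|d s IH] c.
  by move=> _ _; rewrite /= subnn; split => // a b; lia.
rewrite [path _ _ _]/= [last _ _]/= => /andP [cd pds] lv.
have [h1 h2] := IH d pds lv.
have dl : d <= last d s.
  have := order_path_min ltn_trans pds.
  by case: (s) => //= e s' /andP [de /allP h]; have := mem_last e s';
     rewrite inE => /orP [/eqP -> |/h]; [exact: ltnW|exact: ltnW].
set B := take (d - c) (drop c v).
have sB : size B = d - c by rewrite size_takel // size_drop; lia.
have uB : uniq B by rewrite take_uniq // drop_uniq.
have hB := st_perm uB; rewrite sB in hB.
have nB k : k < d - c -> nt B k = nt v (c + k) by move=> hk; rewrite nth_take // nth_drop.
have -> : blocks c (d :: s) v = cross (st B) (blocks d s v) by [].
have e : last d s - c = (d - c) + (last d s - d) by lia.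
rewrite e; split; first exact: cross_perm.
move=> a b ab bn; rewrite (cross_lt hB h1 ab bn) /separated /=.
case: ltnP => bd.
  rewrite st_lt ?sB //; last exact: ltn_trans ab bd.
  rewrite !nB //; last exact: ltn_trans ab bd.
  have -> : (c + a < d <= c + b) = false by lia.
  rewrite (_ : has _ s = false) //.
  apply/negbTE/hasPn => p ps; have := order_path_min ltn_trans pds.
  by move/allP/(_ p ps) => /=; lia.
case: ltnP => ad.
  by rewrite (_ : (c + a < d <= c + b) = true) //; lia.
rewrite h2; try lia.
have -> : (c + a < d <= c + b) = false by lia.
have shift k : d - c <= k -> d + (k - (d - c)) = c + k by lia.
by rewrite !shift // ltnW // (leq_ltn_trans ad).
Qed.

Lemma sort_undup_sorted J : sorted ltn J -> sort leq (undup J) = J.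
Proof.
move=> sJ; rewrite undup_id; last exact: sorted_uniq ltn_trans ltnn _ sJ.
by apply: (sorted_sort leq_trans); apply: sub_sorted sJ => a b /ltnW.
Qed.

Definition cutset n J := sorted ltn J && all (fun p => 0 < p < n) J.

Lemma vJP n v J : uniq v -> size v = n -> 0 < n -> cutset n J ->
  is_perm n (vJ v J) /\
  forall a b, a < b -> b < n ->
    (nt (vJ v J) b < nt (vJ v J) a) = ~~ separated J a b && (nt v b < nt v a).
Proof.
move=> uv sv n0 /andP [sJ bJ].
have eq : vJ v J = blocks 0 (rcons J n) v.
  by rewrite /vJ sort_undup_sorted // sv cats1.
have pJ : path ltn 0 (rcons J n).
  rewrite rcons_path; apply/andP; split.
    by case: (J) sJ bJ => //= p s -> /andP [/andP [-> _] _].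
  by have := mem_last 0 J; rewrite inE => /orP [/eqP ->|/(allP bJ)/andP []].
have := @blocksP 0 (rcons J n) v uv pJ; rewrite last_rcons sv subn0 -eq.
move=> /(_ (leqnn _)) [h1 h2]; split => // a b ab bn.
rewrite h2 // !add0n /separated -cats1 has_cat /= orbF.
by rewrite (_ : (a < n <= b) = false) ?orbF //; lia.
Qed.

Lemma vJ_perm n v J : is_perm n v -> 0 < n -> cutset n J -> is_perm n (vJ v J).
Proof. by case/is_permP=> sv uv _ n0 cJ; case: (vJP uv sv n0 cJ). Qed.

Lemma vJ_lt n v J a b : is_perm n v -> cutset n J -> a < b -> b < n ->
  (nt (vJ v J) b < nt (vJ v J) a) = ~~ separated J a b && (nt v b < nt v a).
Proof.
case/is_permP=> sv uv _ cJ ab bn; have n0 : 0 < n by lia.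
by case: (vJP uv sv n0 cJ) => _; apply.
Qed.

Lemma vJ_nil n v : is_perm n v -> 0 < n -> vJ v [::] = v.
Proof.
move=> hv n0; apply: (perm_order_eq (vJ_perm hv n0 _) hv) => // a b ab bn.
by rewrite (vJ_lt hv).
Qed.

Lemma vJ_cons n v p J : is_perm n v -> 0 < p < n -> cutset (n - p) J ->
  vJ v (p :: map (addn p) J) = cross (st (take p v)) (vJ (st (drop p v)) J).
Proof.
move=> hv pn cJ; have [sv uv _] := is_permP hv.
have sT : size (take p v) = p by rewrite size_takel // sv; lia.
have sD : size (drop p v) = n - p by rewrite size_drop sv.
have hT := st_perm (take_uniq p uv); rewrite sT in hT.
have hD := st_perm (drop_uniq p uv); rewrite sD in hD.
have n0 : 0 < n by lia.
have cpJ : cutset n (p :: map (addn p) J).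
  case/andP: cJ => sJ bJ; apply/andP; split.
    rewrite /= path_min_sorted; last first.
      by rewrite all_map; apply/allP => q /(allP bJ) /=; lia.
    by rewrite sorted_map; apply: sub_sorted sJ => a b /=; rewrite ltn_add2l.
  rewrite /= pn /= all_map; apply/allP => q /(allP bJ) /=; lia.
have hR := vJ_perm hD (ltac:(lia) : 0 < n - p) cJ.
have hC := cross_perm hT hR; rewrite subnKC in hC; last by lia.
apply: (perm_order_eq (vJ_perm hv n0 cpJ) hC) => a b ab bn.
rewrite (vJ_lt hv cpJ ab bn) (cross_lt hT hR ab); last by lia.
rewrite /separated /= has_map.
case: (ltnP b p) => bp.
  rewrite andbF /=.
  rewrite st_lt ?sT //; last exact: ltn_trans ab bp.
  rewrite !nth_take //; last exact: ltn_trans ab bp.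
  rewrite (_ : has _ J = false) //.
  by apply/negbTE/hasPn => q /(allP (proj2 (andP cJ))) /=; lia.
case: (ltnP a p) => ap //=.
rewrite (vJ_lt hD cJ); [|lia|lia].
rewrite st_lt ?sD; [|lia|lia].
rewrite !nth_drop !subnKC //; congr (~~ _ && _).
by apply: eq_has => q /=; lia.
Qed.

End Blocks.

Section GaloisConnection.
Local Open Scope nat_scope.
Implicit Types (s u v w x y z J : seq nat) (n : nat).

Lemma subset_DesP n z J : size z = n ->
  reflect (forall i, 0 < i < n -> i \notin J -> nt z i.-1 <= nt z i) (subsetb (Des z) J).
Proof.
move=> sz; apply: (iffP allP) => [h i hi iJ|h i].
  rewrite leqNgt; apply: contra iJ => lt; apply: h.
  by rewrite mem_filter lt mem_iota sz; lia.
rewrite mem_filter mem_iota sz => /andP [lt hi].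
by apply: contraLR lt => iJ; rewrite -leqNgt h //; lia.
Qed.

Lemma subset_Des_increasing n z J a b : is_perm n z -> subsetb (Des z) J ->
  a < b -> b < n -> ~~ separated J a b -> nt z a < nt z b.
Proof.
move=> hz /(subset_DesP _ (is_perm_size hz)) dz; elim: b => // b IH ab bn nsep.
have step : nt z b < nt z b.+1.
  rewrite ltn_neqAle (is_perm_inj hz) //; last by lia.
  rewrite neq_ltn ltnSn /=; apply: (dz b.+1) => //.
  by apply: contra nsep => bJ; apply/hasP; exists b.+1 => //; lia.
case: (ltngtP a b) ab => [ab _|ba|-> //]; last by lia.
apply: ltn_trans step; apply: IH => //; first by lia.
by apply: contra nsep => /hasP [p pJ hp]; apply/hasP; exists p => //; lia.
Qed.

Lemma weak_le_permcompP n y z w : is_perm n y -> is_perm n z -> is_perm n w ->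
  reflect (forall a b, a < n -> b < n -> nt z a < nt z b -> nt y b < nt y a ->
             nt w (nt z b) < nt w (nt z a))
          (weak_le (permcomp y (pinv z)) w).
Proof.
move=> hy hz hw; have hz' := pinv_perm hz.
have szy : size (permcomp y (pinv z)) = n by rewrite size_map (is_perm_size hz').
apply: (iffP (weak_leP szy (is_perm_size hw))) => h a b.
  move=> an bn zab yba; apply: h => //; first exact: is_perm_lt hz bn.
  by rewrite !nth_permcomp ?(is_perm_size hz') ?(is_perm_lt hz) // !(nth_pinvK hz).
move=> ab bn; have an := ltn_trans ab bn.
rewrite !nth_permcomp ?(is_perm_size hz') // => yy.
have := h (nt (pinv z) a) (nt (pinv z) b); rewrite !(nth_pinvKV hz) //.
by apply => //; apply: is_perm_lt hz' _.
Qed.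

Lemma permcomp_iota n z : is_perm n z -> permcomp (iota 0 n) z = z.
Proof.
move=> hz; rewrite /permcomp -[RHS]map_id; apply/eq_in_map => i.
by rewrite (is_perm_mem _ hz) => hi; rewrite nth_iota.
Qed.

Lemma weak_le_pinvP n z w : is_perm n z -> is_perm n w ->
  reflect (forall a b, b < a -> a < n -> nt z a < nt z b -> nt w (nt z b) < nt w (nt z a))
          (weak_le (pinv z) w).
Proof.
move=> hz hw; rewrite -(permcomp_iota (pinv_perm hz)).
have hi : is_perm n (iota 0 n) by apply: perm_refl.
apply: (iffP (weak_le_permcompP hi hz hw)) => h a b.
  by move=> ba an zz; apply: h => //; rewrite ?nth_iota //; lia.
by move=> an bn zz; rewrite !nth_iota // => ba; apply: h.
Qed.

Lemma count_separated J a b : a < b ->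
  count (fun p => p <= b) J = count (fun p => p <= a) J + count (fun p => a < p <= b) J.
Proof. by move=> ab; elim: J => //= p J ->; lia. Qed.

(* The greatest [v'] with [vJ v' J] below [w] along [z]: its [J]-blocks are in
   decreasing order, and each block is ordered like [w \o z]. *)
Definition block_max J z w :=
  st [seq (size J - count (fun p => p <= a) J) * size w + nt w (nt z a)
     | a <- iota 0 (size w)].

Lemma block_maxP n J z w : is_perm n z -> is_perm n w ->
  is_perm n (block_max J z w) /\
  forall a b, a < b -> b < n ->
    (nt (block_max J z w) b < nt (block_max J z w) a) =
    separated J a b || (nt w (nt z b) < nt w (nt z a)).
Proof.
move=> hz hw; rewrite /block_max (is_perm_size hw).
set key := fun a : nat => _.
have keyE a : key a = (size J - count (fun p => p <= a) J) * n + nt w (nt z a) by [].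
have lt a : a < n -> nt w (nt z a) < n by move=> an; rewrite !(is_perm_lt hw, is_perm_lt hz).
have us : uniq (map key (iota 0 n)).
  rewrite map_inj_in_uniq ?iota_uniq // => a b; rewrite !mem_iota => /= an bn.
  rewrite !keyE => /(congr1 (modn^~ n)); rewrite !modnMDl !modn_small ?lt //.
  move/eqP; rewrite (is_perm_inj hw) ?(is_perm_lt hz) // (is_perm_inj hz) //.
  by move/eqP.
have hs := st_perm us; rewrite size_map size_iota in hs; split => // a b ab bn.
have an := ltn_trans ab bn.
rewrite st_lt ?size_map ?size_iota // !(nth_map 0) ?size_iota // !nth_iota // !add0n !keyE.
rewrite (count_separated J ab) /separated has_count.
have := count_size (fun p => p <= b) J; rewrite (count_separated J ab).
have := lt a an; have := lt b bn.
set A := nt w _; set B := nt w _; set ca := count _ _; set cb := count _ _.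
move=> hB hA hc; case: (posnP cb) => [->|cb0]; first by rewrite addn0 ltn_add2l.
rewrite /=; have -> : size J - ca = (size J - (ca + cb)) + cb by lia.
by rewrite mulnDl; nia.
Qed.

Lemma block_max_perm n J z w : is_perm n z -> is_perm n w -> is_perm n (block_max J z w).
Proof. by move=> hz hw; case: (block_maxP J hz hw). Qed.

Lemma block_max_lt n J z w a b : is_perm n z -> is_perm n w -> a < b -> b < n ->
  (nt (block_max J z w) b < nt (block_max J z w) a) =
  separated J a b || (nt w (nt z b) < nt w (nt z a)).
Proof. by move=> hz hw; case: (block_maxP J hz hw) => _; apply. Qed.

Lemma weak_le_vJ n v J z w : is_perm n v -> is_perm n z -> is_perm n w ->
  0 < n -> cutset n J -> subsetb (Des z) J ->
  weak_le (permcomp (vJ v J) (pinv z)) w =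
  weak_le (pinv z) w && weak_le v (block_max J z w).
Proof.
move=> hv hz hw n0 cJ dz; have hy := vJ_perm hv n0 cJ.
have hg := block_max_perm J hz hw.
have zinc a b : a < b -> b < n -> nt z b < nt z a -> separated J a b.
  move=> ab bn zz; apply: contraLR zz => ns; rewrite -leqNgt ltnW //.
  exact: subset_Des_increasing dz ab bn ns.
apply/(weak_le_permcompP hy hz hw)/andP => [h|[]].
  split.
    apply/(weak_le_pinvP hz hw) => a b ba an zz.
    have bn := ltn_trans ba an.
    apply: h => //; rewrite (perm_ltn_total hy) //; last by rewrite neq_ltn ba.
    by rewrite (vJ_lt hv cJ ba an) (zinc b a).
  apply/(weak_leP (is_perm_size hv) (is_perm_size hg)) => a b ab bn vv.
  rewrite (block_max_lt J hz hw ab bn); case: (boolP (separated J a b)) => //= ns.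
  apply: h => //; first exact: ltn_trans ab bn.
    exact: subset_Des_increasing dz ab bn ns.
  by rewrite (vJ_lt hv cJ) // ns.
move=> /(weak_le_pinvP hz hw) h1 /(weak_leP (is_perm_size hv) (is_perm_size hg)) h2.
move=> a b an bn zz yy; case: (ltngtP a b) => [ab|ba|e]; last 2 first.
- exact: h1.
- by rewrite e ltnn in zz.
move: yy; rewrite (vJ_lt hv cJ ab bn) => /andP [ns /(h2 a b ab bn)].
by rewrite (block_max_lt J hz hw ab bn) (negbTE ns).
Qed.

End GaloisConnection.

Section Subsequences.
Implicit Types (s J R : seq nat).

Lemma mem_subseqs R s : (R \in subseqs s) = subseq R s.
Proof.
elim: s R => [|x s IH] R; first by rewrite mem_seq1 subseq0.
rewrite mem_cat IH; case: R => [|y R]; first by rewrite sub0seq orbT.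
have -> : (y :: R \in map (cons x) (subseqs s)) = (y == x) && subseq R s.
  apply/mapP/andP => [[R' hR' [-> ->]]|[/eqP -> hR]]; first by rewrite -IH.
  by exists R; rewrite ?IH.
rewrite /=; case: eqP => //= _; case: (boolP (subseq R s)) => //= nR.
by apply: contraNF nR; apply: subseq_trans; apply: subseq_cons.
Qed.

Lemma subseqs_map (f : nat -> nat) s : subseqs (map f s) = map (map f) (subseqs s).
Proof. by elim: s => //= x s ->; rewrite map_cat -!map_comp. Qed.

Lemma sum_subseqs_all (q : pred nat) s (F : seq nat -> rat) :
  \sum_(J <- subseqs s | all q J) F J = \sum_(J <- subseqs (filter q s)) F J.
Proof.
elim: s F => [|x s IH] F; first by rewrite /= !big_cons !big_nil.
rewrite /= big_cat big_map /= IH; case: (q x) => /=.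
  by rewrite big_cat big_map /= IH.
by rewrite big_pred0_eq add0r.
Qed.

Lemma sum_subseqs_iota a m (F : seq nat -> rat) :
  \sum_(J <- subseqs (iota a m)) F J =
  F [::] + \sum_(p <- iota a m) \sum_(J <- subseqs (iota p.+1 (a + m - p.+1))) F (p :: J).
Proof.
elim: m a => [|m IH] a /=; first by rewrite !big_seq1 big_nil addr0.
rewrite big_cat big_map IH big_cons addrCA; congr (_ + _).
  by congr (\sum_(J <- subseqs (iota _ _)) _); lia.
congr (_ + _); apply: eq_bigr => p _.
by congr (\sum_(J <- subseqs (iota _ _)) _); lia.
Qed.

Lemma sum_subseqs_alternating (good : pred nat) s : uniq s ->
  \sum_(J <- subseqs s | all (fun p => (p \in J) || good p) s) (-1) ^+ size J =
  if has good s then 0 else (-1) ^+ size s :> rat.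
Proof.
elim: s => [_|x s IH /= /andP [xs us]]; first by rewrite big_cons big_nil addr0.
rewrite big_cat big_map /=.
under eq_bigl => J do rewrite mem_head /=.
rewrite (eq_bigl (fun J => all (fun p => (p \in J) || good p) s)); last first.
  move=> J; apply: eq_in_all => p ps; rewrite inE.
  by case: eqP => // e; rewrite e (negbTE xs) in ps.
under eq_bigr do rewrite exprS.
rewrite -mulr_sumr IH // big_seq_cond.
rewrite (eq_bigl (fun J => (J \in subseqs s) &&
          (good x && all (fun p => (p \in J) || good p) s))); last first.
  move=> J; case: (boolP (J \in subseqs s)) => //=; rewrite mem_subseqs => /mem_subseq Js.
  by rewrite (negbTE (contra (Js x) xs)).
rewrite -big_seq_cond; case: (good x) => /=; last by rewrite big_pred0_eq addr0; case: ifP; rewrite ?mulr0 -?exprS.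
by rewrite IH // mulN1r addNr.
Qed.

Lemma cutset_subseqs n J : J \in subseqs (iota 1 n.-1) -> cutset n J.
Proof.
rewrite mem_subseqs => sJ; apply/andP; split.
  exact: (subseq_sorted ltn_trans sJ (iota_ltn_sorted _ _)).
by apply/allP => q /(mem_subseq sJ); rewrite mem_iota; lia.
Qed.

End Subsequences.

Section AlternatingSum.
Variables (n : nat) (v w z : seq nat).
Hypotheses (n_gt0 : (0 < n)%N) (hv : is_perm n v) (hw : is_perm n w) (hz : is_perm n z).
Local Open Scope nat_scope.
Implicit Types (J K R : seq nat).
Let G := GDes v.

Definition block_fit J :=
  [&& subsetb (Des z) J, weak_le (pinv z) w & v == block_max J z w].

Lemma block_fitP J :
  reflect [/\ forall i, 0 < i < n -> i \notin J -> nt z i.-1 <= nt z i,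
              weak_le (pinv z) w
            & forall a b, a < b -> b < n ->
                (nt v b < nt v a) = separated J a b || (nt w (nt z b) < nt w (nt z a))]
          (block_fit J).
Proof.
apply: (iffP and3P) => -[h1 h2 h3]; split => //.
- exact/(subset_DesP _ (is_perm_size hz)).
- by move=> a b ab bn; rewrite (eqP h3) (block_max_lt J hz hw).
- exact/(subset_DesP _ (is_perm_size hz)).
apply/eqP/(perm_order_eq hv (block_max_perm J hz hw)) => a b ab bn.
by rewrite h3 // (block_max_lt J hz hw).
Qed.

Lemma mem_GDesP p :
  reflect (0 < p < n /\ forall a b, a < p <= b -> b < n -> nt v b < nt v a) (p \in G).
Proof.
rewrite mem_filter mem_iota (is_perm_size hv); apply: (iffP andP) => -[h1 h2].
  split; first by lia.
  move=> a b pab bn; move/allP: h1 => /(_ a); rewrite mem_iota => /(_ ltac:(lia)).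
  by move/allP => /(_ b); rewrite mem_iota; apply; lia.
split; last by lia.
apply/allP => a; rewrite mem_iota => ha; apply/allP => b; rewrite mem_iota => hb.
by apply: h2; lia.
Qed.

Lemma GDes_separated J a b : {subset J <= G} -> b < n -> separated J a b -> nt v b < nt v a.
Proof. by move=> JG bn /hasP [p /JG/mem_GDesP [_ h] /h]; apply. Qed.

Lemma block_fit_GDes J : cutset n J -> block_fit J -> {subset J <= G}.
Proof.
case/andP=> _ bJ /block_fitP [_ _ h] p pJ.
apply/mem_GDesP; split; first exact: (allP bJ).
move=> a b pab bn; rewrite h //; last by lia.
by apply/orP; left; apply/hasP; exists p.
Qed.

Lemma separatedS J K a b : {subset J <= K} -> separated J a b -> separated K a b.
Proof. by move=> JK /hasP [p /JK pK h]; apply/hasP; exists p. Qed.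

Lemma block_fitS J K : {subset J <= K} -> {subset K <= G} -> block_fit J -> block_fit K.
Proof.
move=> JK KG /block_fitP [h1 h2 h3]; apply/block_fitP; split => //.
  by move=> i hi iK; apply: h1 => //; apply: contra iK; apply: JK.
move=> a b ab bn; case: (boolP (separated K a b)) => sK /=.
  exact: GDes_separated sK.
by rewrite h3 // (negbTE (contra (separatedS JK) sK)).
Qed.

Definition removable p := block_fit (filter (predC1 p) G).

(* If each cut in [G] outside [J] can be removed on its own, then all of them can
   be removed at once: two positions separated only by such cuts are linked by a
   chain of inversions, each crossing a single cut. *)
Lemma block_fit_removable J : {subset J <= G} ->
  block_fit J = block_fit G && all (fun p => (p \in J) || removable p) G.
Proof.
move=> JG; apply/idP/andP => [fJ|[fG /allP rem]].
  split; first exact: block_fitS fJ.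
  apply/allP => p pG; case: (boolP (p \in J)) => //= npJ.
  apply: block_fitS fJ => q; last by rewrite mem_filter => /andP [].
  by move=> qJ; rewrite mem_filter /= JG // andbT; apply: contra npJ => /eqP <-.
have /block_fitP [g1 g2 g3] := fG.
have chain k a b : b - a < k -> a < b -> b < n -> ~~ separated J a b ->
    separated G a b -> nt w (nt z b) < nt w (nt z a).
  elim: k a b => // k IH a b lk ab bn nsJ sG.
  have /hasP [p pG pab] := sG.
  have npJ : p \notin J by apply: contra nsJ => pJ; apply/hasP; exists p.
  have := rem p pG; rewrite (negbTE npJ) /= => /block_fitP [_ _ r3].
  case: (boolP (separated (filter (predC1 p) G) a b)) => [sq|nsq]; last first.
    have := r3 a b ab bn; rewrite (negbTE nsq) /= => <-.
    exact: GDes_separated sG.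
  have /hasP [q] := sq; rewrite mem_filter /= => /andP [qp qG] qab.
  have [c [c1 c2 s1 s2]] : exists c, [/\ a < c, c < b, separated G a c & separated G c b].
    case/andP: pab => ap pb; case/andP: qab => aq qb.
    case: (ltngtP p q) => [pq|pq|e]; last by rewrite e eqxx in qp.
      exists p; split=> //; first exact: leq_trans pq qb.
        by apply/hasP; exists p => //; rewrite ap leqnn.
      by apply/hasP; exists q => //; rewrite pq qb.
    exists q; split=> //; first exact: leq_trans pq pb.
      by apply/hasP; exists q => //; rewrite aq leqnn.
    by apply/hasP; exists p => //; rewrite pq pb.
  have nsub a' b' : a <= a' -> b' <= b -> ~~ separated J a' b'.
    move=> aa bb; apply: contra nsJ => /hasP [r rJ /andP [ar rb]]; apply/hasP.
    by exists r; rewrite // (leq_ltn_trans aa ar) (leq_trans rb bb).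
  have [l1 l2 cn] : [/\ c - a < k, b - c < k & c < n] by split; move: lk c1 c2 bn; clear; lia.
  apply: (@ltn_trans (nt w (nt z c))); apply: IH => //; apply: nsub => //; exact: ltnW.
apply/block_fitP; split => //.
  move=> i hi iJ; case: (boolP (i \in G)) => iG; last exact: g1.
  have := rem i iG; rewrite (negbTE iJ) /= => /block_fitP [r1 _ _].
  by apply: r1; rewrite // mem_filter /= eqxx.
move=> a b ab bn; case: (boolP (separated J a b)) => sJ /=.
  exact: GDes_separated sJ.
case: (boolP (separated G a b)) => sG; last by rewrite g3 // (negbTE sG).
by rewrite (@GDes_separated G) //; apply/esym/(chain (b - a).+1).
Qed.

Lemma GDes_sorted : sorted ltn G.
Proof. by apply: sorted_filter; [apply: ltn_trans | apply: iota_ltn_sorted]. Qed.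

Lemma GDes_uniq : uniq G.
Proof. by rewrite filter_uniq ?iota_uniq. Qed.

Lemma cutset_GDes R : subseq R G -> cutset n R.
Proof.
move=> RG; apply/andP; split; first exact: (subseq_sorted ltn_trans RG GDes_sorted).
by apply/allP => p /(mem_subseq RG)/mem_GDesP [].
Qed.

Lemma inC_block_fit : inC G v w z = block_fit G && ~~ has removable G.
Proof.
rewrite /inC (is_perm_size hv) /block_fit.
case: (boolP (subsetb (Des z) G)) => //= dz.
have cG := cutset_GDes (subseq_refl G).
rewrite (weak_le_vJ hv hz hw n_gt0 cG dz).
case: (boolP (weak_le (pinv z) w)) => //= zw.
have hg := block_max_perm G hz hw.
have -> : weak_le v (block_max G z w) &&
   (all (fun v' => weak_le v v' && weak_le (permcomp (vJ v' G) (pinv z)) w ==> (v' == v))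
     (allperms n) &&
    all (fun R => subsetb (Des z) R && weak_le (permcomp (vJ v R) (pinv z)) w ==> perm_eq R G)
     (subseqs G)) =
  (v == block_max G z w) &&
  all (fun R => subsetb (Des z) R && weak_le (permcomp (vJ v R) (pinv z)) w ==> perm_eq R G)
     (subseqs G).
  rewrite andbA; congr (_ && _); apply/andP/eqP => [[vg /allP h]|vg].
    have := h (block_max G z w); rewrite mem_allperms => /(_ hg).
    by rewrite vg (weak_le_vJ hg hz hw n_gt0 cG dz) zw (weak_le_refl hg) => /eqP.
  split; first by rewrite -vg (weak_le_refl hv).
  apply/allP => v'; rewrite mem_allperms => hv'; apply/implyP => /andP [vv'].
  rewrite (weak_le_vJ hv' hz hw n_gt0 cG dz) zw -vg /= => v'v.
  by apply/eqP; apply: (weak_le_anti hv' hv v'v vv').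
case: (boolP (v == block_max G z w)) => //= vg.
have fG : block_fit G by apply/and3P.
have fitE R : subseq R G ->
    subsetb (Des z) R && weak_le (permcomp (vJ v R) (pinv z)) w = block_fit R.
  move=> RG; rewrite /block_fit; case: (boolP (subsetb (Des z) R)) => //= dR.
  rewrite (weak_le_vJ hv hz hw n_gt0 (cutset_GDes RG) dR) zw /=.
  apply/idP/eqP => [vR|{1}->]; last exact: weak_le_refl (block_max_perm R hz hw).
  apply: (weak_le_anti hv (block_max_perm R hz hw) vR).
  apply/(weak_leP (is_perm_size (block_max_perm R hz hw)) (is_perm_size hv)).
  move=> a b ab bn; rewrite (block_max_lt R hz hw ab bn).
  case: (boolP (separated R a b)) => [sR _|nsR /= ww].
    exact: GDes_separated (mem_subseq RG) bn sR.
  by rewrite (eqP vg) (block_max_lt G hz hw ab bn) ww orbT.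
apply/allP/hasPn => [h p pG|h R].
  have sub : subseq (filter (predC1 p) G) G by apply: filter_subseq.
  apply/negP => rp; have := h _ (_ : filter (predC1 p) G \in subseqs G).
  rewrite mem_subseqs fitE // -/(removable p) rp => /(_ sub)/perm_mem/(_ p).
  by rewrite mem_filter /= eqxx pG.
rewrite mem_subseqs => RG; rewrite fitE //; apply/implyP.
rewrite (block_fit_removable (mem_subseq RG)) => /andP [_ /allP hR].
apply: uniq_perm; [exact: subseq_uniq RG GDes_uniq | exact: GDes_uniq |].
move=> p; apply/idP/idP => [/(mem_subseq RG) //|pG].
by have := hR p pG; rewrite (negbTE (h p pG)) orbF.
Qed.

Lemma sum_block_fit :
  (\sum_(J <- subseqs (iota 1 n.-1) | block_fit J) (-1) ^+ size J =
   (-1) ^+ size G * (inC G v w z)%:R :> rat)%R.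
Proof.
rewrite big_seq_cond.
rewrite (eq_bigl (fun J => (J \in subseqs (iota 1 n.-1)) &&
           (all (mem G) J && block_fit J))); last first.
  move=> J; case: (boolP (J \in subseqs (iota 1 n.-1))) => //= /cutset_subseqs cJ.
  case: (boolP (block_fit J)) => [fJ|]; last by rewrite andbF.
  by rewrite andbT; apply/esym/allP => p; apply: block_fit_GDes.
rewrite -big_seq_cond big_mkcondr sum_subseqs_all.
have -> : filter (mem G) (iota 1 n.-1) = G.
  rewrite {1}/G /GDes -(is_perm_size hv); apply: eq_in_filter => p hp.
  by rewrite /= mem_filter hp andbT.
rewrite inC_block_fit big_seq.
rewrite (eq_bigr (fun J => if block_fit G && all (fun p => (p \in J) || removable p) G
           then (-1) ^+ size J else 0)%R); last first.
  by move=> J; rewrite mem_subseqs => /mem_subseq JG; rewrite block_fit_removable.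
rewrite -big_seq -big_mkcond; case: (block_fit G) => /=; last first.
  by rewrite big_pred0_eq mulr0.
rewrite sum_subseqs_alternating ?GDes_uniq //.
by case: (has _ _); rewrite ?mulr0 ?mulr1.
Qed.

End AlternatingSum.

Section Coefficients.
Implicit Types (x y : eltSS) (u w z : seq nat).

Lemma coefSS_flatten (s : seq eltSS) w : coefSS (flatten s) w = \sum_(x <- s) coefSS x w.
Proof. by rewrite /coefSS big_flatten. Qed.

Lemma coefSS_scale c x w : coefSS (scaleSS c x) w = c * coefSS x w.
Proof. by rewrite /coefSS big_map mulr_sumr. Qed.

Lemma coefSS_mulFF u y w :
  coefSS (mulSS (FF u) y) w = \sum_(b <- y) b.1 * (count_mem w (prodF u b.2))%:R.
Proof.
rewrite /mulSS /= cats0 coefSS_flatten big_map; apply: eq_bigr => b _.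
rewrite /coefSS big_map /= mul1r big_const_seq iter_addr_0 mulr_natr.
by congr (_ *+ _).
Qed.

Lemma sum_coefSS y (s : seq (seq nat)) (H : seq nat -> rat) : uniq s ->
  (forall w, w \notin s -> coefSS y w = 0) ->
  \sum_(b <- y) b.1 * H b.2 = \sum_(w <- s) coefSS y w * H w.
Proof.
move=> us y0; set W := undup (map snd y ++ s).
transitivity (\sum_(w <- W) coefSS y w * H w).
  under [RHS]eq_bigr => w _ do rewrite /coefSS mulr_suml big_mkcond.
  rewrite exchange_big /= [LHS]big_seq [RHS]big_seq; apply: eq_bigr => b yb.
  have bW : b.2 \in W by rewrite mem_undup mem_cat map_f.
  rewrite (bigD1_seq b.2) ?undup_uniq //= eqxx big1 ?addr0 // => w.
  by rewrite eq_sym => /negbTE ->.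
rewrite (bigID (mem s)) /= [X in _ + X]big1 ?addr0; last first.
  by move=> w /y0 ->; rewrite mul0r.
rewrite -big_filter; apply: perm_big; apply: uniq_perm => //.
  by rewrite filter_uniq ?undup_uniq.
by move=> w; rewrite mem_filter mem_undup mem_cat; case: (w \in s); rewrite ?orbT.
Qed.

Lemma coefSS_MM n w (x : seq nat) : is_perm n w ->
  coefSS (MM w) x = if is_perm n x && weak_le w x then mobius w x else 0.
Proof.
move=> hw; rewrite /coefSS big_map big_filter_cond (is_perm_size hw) /=.
case: ifP => [/andP [hx wx]|h].
  rewrite (@bigD1_seq_cond _ _ _ _ _ x) ?mem_allperms ?allperms_uniq ?wx ?eqxx //.
  by rewrite big_pred0 ?addr0 // => z; case: eqP; rewrite ?andbF.
rewrite big_seq_cond big_pred0 // => z; rewrite mem_allperms.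
by case: eqP => [->|]; rewrite ?andbF // andbT h.
Qed.

End Coefficients.

Section ShuffleProduct.
Local Open Scope nat_scope.
Implicit Types (u v w x y z a : seq nat) (n p q : nat).

Lemma sorted_perm n z : is_perm n z -> sorted ltn z -> z = iota 0 n.
Proof.
move=> hz sz; apply: (irr_sorted_eq ltn_trans ltnn sz (iota_ltn_sorted _ _)).
by case: (is_permP hz).
Qed.

Lemma count_prodF_nil w x : count_mem x (prodF [::] w) = (w == x).
Proof.
rewrite /prodF count_map count_filter add0n.
have -> : cross [::] w = w by rewrite /cross cat0s (eq_map (g := id)) ?map_id.
set m := size w.
have wi : permcomp w (pinv (iota 0 m)) = w.
  apply: (@eq_from_nth _ 0); first by rewrite size_map size_pinv size_iota.
  move=> i; rewrite size_map size_pinv size_iota => hi.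
  rewrite nth_permcomp ?size_pinv ?size_iota // nth_pinv ?size_iota //.
  by rewrite -[X in index X _](@nth_iota 0 0 m i) // index_uniq ?size_iota ?iota_uniq.
have hi : is_perm m (iota 0 m) by apply: perm_refl.
rewrite (eq_in_count (a2 := fun z => (w == x) && (z == iota 0 m))); last first.
  move=> z; rewrite mem_allperms => hz; rewrite /= /shuffle_ok take0 drop0 /=.
  apply/andP/andP => [[/eqP e sz]|[/eqP <- /eqP ->]].
    by rewrite -e (sorted_perm hz sz) wi.
  by rewrite wi iota_ltn_sorted.
case: (w == x) => /=; last by rewrite count_pred0.
by rewrite (count_uniq_mem _ (allperms_uniq _)) mem_allperms hi.
Qed.

Lemma count_prodF p q u w x : is_perm p u -> is_perm q w ->
  count_mem x (prodF u w) =
  is_perm (p + q) x && shuffle_ok p (permcomp (pinv x) (cross u w)).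
Proof.
move=> hu hw; have hc := cross_perm hu hw.
rewrite /prodF (is_perm_size hu) (is_perm_size hw) count_map count_filter.
case: (boolP (is_perm _ x)) => hx; last first.
  apply/eqP; rewrite -leqn0 leqNgt -has_count; apply/hasPn => z; rewrite mem_allperms => hz.
  apply: contra hx => /= /andP [/eqP <- _].
  exact: permcomp_perm hc (pinv_perm hz).
set t := permcomp (pinv x) _.
have ht : is_perm (p + q) t := permcomp_perm (pinv_perm hx) hc.
rewrite (eq_in_count (a2 := fun z => shuffle_ok p t && (z == t))); last first.
  move=> z; rewrite mem_allperms => hz /=.
  apply/andP/andP => [[/eqP e sz]|[st /eqP ->]].
    by rewrite /t -e (pinv_permcompK hc hz).
  by rewrite /t (permcomp_pinvK hx hc).
case: (shuffle_ok p t) => /=; last by rewrite count_pred0.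
by rewrite (count_uniq_mem _ (allperms_uniq _)) mem_allperms ht.
Qed.

Definition upper p x := [seq i - p | i <- x & p <= i].

Lemma map_upper p x : map (addn p) (upper p x) = filter (leq p) x.
Proof.
rewrite -map_comp -[RHS]map_id; apply/eq_in_map => i.
by rewrite mem_filter => /andP [pi _] /=; rewrite subnKC.
Qed.

Lemma upper_perm p q x : is_perm (p + q) x -> is_perm q (upper p x).
Proof.
move=> hx; apply: (perm_map_inj (@addnI p)).
rewrite map_upper -iotaDl addn0; apply: perm_trans (perm_filter _ hx) _.
rewrite iotaD filter_cat (eq_in_filter (a2 := pred0)) ?filter_pred0; last first.
  by move=> i; rewrite mem_iota /=; lia.
rewrite (eq_in_filter (a2 := predT)) ?filter_predT //.
by move=> i; rewrite mem_iota /=; lia.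
Qed.

Lemma sorted_pinv_filter n x (P : pred nat) : is_perm n x ->
  sorted ltn (permcomp (pinv x) (filter P x)).
Proof.
move=> hx; rewrite sorted_map; apply: sorted_filter; first by move=> b a c; apply: ltn_trans.
apply/(sortedP 0) => i; rewrite (is_perm_size hx) => hi /=.
by rewrite !(nth_pinvK hx) //; lia.
Qed.

Lemma sorted_pinv_upper p q x w : is_perm (p + q) x -> is_perm q w ->
  sorted ltn (permcomp (pinv x) (map (addn p) w)) = (w == upper p x).
Proof.
move=> hx hw; apply/idP/eqP => [sw|->]; last first.
  by rewrite map_upper (sorted_pinv_filter _ hx).
apply: (inj_map (@addnI p)); rewrite map_upper.
have sf := sorted_pinv_filter (leq p) hx.
rewrite /permcomp sorted_map in sw; rewrite /permcomp sorted_map in sf.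
apply: (@irr_sorted_eq _ (relpre (nt (pinv x)) ltn) _ _ _ _ sw sf).
- by move=> b a c; apply: ltn_trans.
- by move=> a /=; rewrite ltnn.
move=> i; rewrite mem_filter (is_perm_mem _ hx).
apply/mapP/andP => [[j]|[pi iq]].
  by rewrite (is_perm_mem _ hw) => jq ->; rewrite leq_addr ltn_add2l.
by exists (i - p); [rewrite (is_perm_mem _ hw); lia | lia].
Qed.

Lemma shuffle_okE p q x u w : is_perm (p + q) x -> is_perm p u -> is_perm q w ->
  shuffle_ok p (permcomp (pinv x) (cross u w)) =
  sorted ltn (permcomp (pinv x) u) && (w == upper p x).
Proof.
move=> hx hu hw; have su := is_perm_size hu.
rewrite /shuffle_ok /permcomp /cross map_cat su.
rewrite take_size_cat ?size_map // drop_size_cat ?size_map //.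
by rewrite (sorted_pinv_upper hx hw).
Qed.

Lemma pinv_upper_lt p q x i j : is_perm (p + q) x -> i < q -> j < q ->
  (nt (pinv (upper p x)) i < nt (pinv (upper p x)) j) =
  (nt (pinv x) (p + i) < nt (pinv x) (p + j)).
Proof.
move=> hx iq jq; have hw := upper_perm hx.
have := sorted_pinv_upper hx hw; rewrite eqxx; set t := permcomp _ _ => st.
have szt : size t = q by rewrite size_map [LHS]size_map (is_perm_size hw).
have tE k : k < q -> nt t (nt (pinv (upper p x)) k) = nt (pinv x) (p + k).
  move=> kq; have kq' := is_perm_lt (pinv_perm hw) kq.
  rewrite nth_permcomp; last by rewrite size_map (is_perm_size hw).
  by rewrite (nth_map 0) ?(is_perm_size hw) // (nth_pinvKV hw).
have mono k l : k < q -> l < q -> k < l -> nt t k < nt t l.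
  by move=> kq lq; apply: (sorted_ltn_nth ltn_trans 0 st); rewrite inE szt.
rewrite -(tE i iq) -(tE j jq).
have := is_perm_lt (pinv_perm hw) iq; have := is_perm_lt (pinv_perm hw) jq.
move: (nt (pinv _) i) (nt (pinv _) j) => k l lq kq.
case: (ltngtP k l) => [kl|lk|->]; last by rewrite ltnn.
  by rewrite mono.
by apply/esym/negbTE; rewrite -leqNgt ltnW ?mono.
Qed.

Lemma subset_Des_nil n z : is_perm n z -> subsetb (Des z) [::] = sorted ltn z.
Proof.
move=> hz; apply/(subset_DesP _ (is_perm_size hz))/(sortedP 0) => h i.
  rewrite (is_perm_size hz) => hi /=; rewrite ltn_neqAle (is_perm_inj hz) //; last by lia.
  by rewrite neq_ltn ltnSn /=; apply: (h i.+1).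
by case: i => // i hi _; apply/ltnW/h; rewrite (is_perm_size hz).
Qed.

Lemma subset_Des_cross p q x a y J : is_perm (p + q) x -> is_perm p a -> is_perm q y ->
  0 < p -> cutset q J ->
  subsetb (Des (permcomp (pinv x) (cross a y))) (p :: map (addn p) J) =
  sorted ltn (permcomp (pinv x) a) && subsetb (Des (permcomp (pinv (upper p x)) y)) J.
Proof.
move=> hx ha hy p0 /andP [_ bJ].
have hw := upper_perm hx; have hc := cross_perm ha hy.
have hz := permcomp_perm (pinv_perm hx) hc.
have hz2 := permcomp_perm (pinv_perm hw) hy.
set z := permcomp _ (cross a y) in hz *.
have z1 i : i < p -> nt z i = nt (pinv x) (nt a i).
  move=> ip; rewrite nth_permcomp ?(is_perm_size hc) ?ltn_addr //.
  by rewrite nth_cross ?(is_perm_size ha) ?(is_perm_size hy) ?ltn_addr // ip.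
have z2 i : i < q -> nt z (p + i) = nt (pinv x) (p + nt y i).
  move=> iq; rewrite nth_permcomp ?(is_perm_size hc) ?ltn_add2l //.
  rewrite nth_cross ?(is_perm_size ha) ?(is_perm_size hy) ?ltn_add2l //.
  by rewrite ltnNge leq_addr /= addKn.
have z2le i j : i < q -> j < q -> (nt z (p + i) <= nt z (p + j)) =
    (nt (permcomp (pinv (upper p x)) y) i <= nt (permcomp (pinv (upper p x)) y) j).
  move=> iq jq; rewrite !z2 // !nth_permcomp ?(is_perm_size hy) //.
  by rewrite leqNgt -(pinv_upper_lt hx) ?(is_perm_lt hy) // -leqNgt.
have sza : size (permcomp (pinv x) a) = p by rewrite size_map (is_perm_size ha).
apply/(subset_DesP _ (is_perm_size hz))/andP => [h|[sa dy]].
  split.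
    apply/(sortedP 0) => i; rewrite sza => ip /=; have ip' := ltnW ip.
    rewrite !nth_permcomp ?(is_perm_size ha) // -!z1 //.
    rewrite ltn_neqAle (is_perm_inj hz) ?ltn_addr // neq_ltn ltnSn /=.
    apply: (h i.+1); first by rewrite ltn_addr.
    rewrite inE negb_or neq_ltn ip /=; apply/mapP => -[j _ e].
    by move: ip; rewrite e ltnNge leq_addr.
  apply/(subset_DesP _ (is_perm_size hz2)) => i hi iJ.
  have [iq iq' e] : [/\ i < q, i.-1 < q & p + i.-1 = (p + i).-1].
    by split; move: hi; clear; lia.
  rewrite -z2le // e; apply: h; first by move: hi; clear; lia.
  by rewrite inE negb_or (mem_map (@addnI p)) iJ andbT; move: hi; clear; lia.
move=> i hi; rewrite inE negb_or => /andP [ip iJ].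
case: (ltngtP i p) ip => // [ip|pi] _.
  rewrite !z1 //; last exact: leq_ltn_trans (leq_pred i) ip.
  case: i hi iJ ip => // i _ _ ip; move/(sortedP 0): sa => /(_ i); rewrite sza => /(_ ip)/ltnW.
  by rewrite !nth_permcomp ?(is_perm_size ha) // ltnW.
have [e1 e2 iq iq'] : [/\ i = p + (i - p), i.-1 = p + (i - p).-1, i - p < q & (i - p).-1 < q].
  by split; move: hi pi; clear; lia.
rewrite e2 [X in _ <= nt z X]e1 z2le //.
apply: (subset_DesP _ (is_perm_size hz2) dy); first by move: iq pi; clear; lia.
by apply: contra iJ => iJ; rewrite e1 mem_map //; apply: addnI.
Qed.

End ShuffleProduct.

Section Antipode.
Implicit Types (u x w J : seq nat).

(* Takeuchi's formula: [x = u_J zeta^-1] has the single solution [zeta = x^-1 u_J],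
   and it contributes exactly when [Des zeta] is contained in [J]. *)
Definition antipode_coef u x : rat :=
  if size u == 0%N then 1 else
  \sum_(J <- subseqs (iota 1 (size u).-1))
    (-1) ^+ (size J).+1 * (subsetb (Des (permcomp (pinv x) (vJ u J))) J)%:R.

Lemma st_take_perm n u p : is_perm n u -> (p <= n)%N -> is_perm p (st (take p u)).
Proof.
case/is_permP=> su uu _ pn; have := st_perm (take_uniq p uu).
by rewrite size_takel ?su.
Qed.

Lemma st_drop_perm n u p : is_perm n u -> is_perm (n - p) (st (drop p u)).
Proof. by case/is_permP=> su uu _; have := st_perm (drop_uniq p uu); rewrite size_drop su. Qed.

Lemma antipode_coef_rec n u x : (0 < n)%N -> is_perm n u -> is_perm n x ->
  antipode_coef u x =
  - \sum_(p <- iota 1 n) (sorted ltn (permcomp (pinv x) (st (take p u))))%:R *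
                         antipode_coef (st (drop p u)) (upper p x).
Proof.
move=> n0 hu hx; have su := is_perm_size hu.
rewrite {1}/antipode_coef su -[n == 0%N]negbK -lt0n n0 /= sum_subseqs_iota.
have -> : iota 1 n = iota 1 n.-1 ++ [:: n].
  by rewrite -{1}(prednK n0) -(addn1 n.-1) iotaD add1n prednK.
rewrite big_cat big_seq1 /=.
rewrite opprD addrC; congr (_ + _); last first.
  rewrite drop_oversize ?su // {1}/antipode_coef eqxx mulr1 take_oversize ?su //.
  rewrite (st_id hu) (vJ_nil hu n0) mulN1r.
  by rewrite (subset_Des_nil (permcomp_perm (pinv_perm hx) hu)).
rewrite -sumrN big_seq [RHS]big_seq; apply: eq_bigr => p; rewrite mem_iota => hp.
have pn : (0 < p < n)%N by lia.
have hT := st_take_perm hu (ltnW (proj2 (andP pn))).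
have hD := st_drop_perm p hu.
have hx' : is_perm (p + (n - p)) x by rewrite subnKC //; lia.
rewrite {1}/antipode_coef (is_perm_size hD) (_ : (n - p == 0)%N = false); last by lia.
have -> : iota p.+1 (1 + n.-1 - p.+1) = map (addn p) (iota 1 (n - p).-1).
  by rewrite -iotaDl addn1; congr (iota _ _); lia.
rewrite subseqs_map big_map mulr_sumr -sumrN big_seq [RHS]big_seq.
apply: eq_bigr => J /cutset_subseqs cJ.
rewrite (vJ_cons hu pn cJ) /= size_map.
have hR := vJ_perm hD (ltac:(lia) : (0 < n - p)%N) cJ.
rewrite (subset_Des_cross hx' hT hR) //; last by case/andP: pn.
rewrite exprS mulN1r mulNr; congr (- _).
by case: sorted; rewrite ?mul0r ?mul1r ?mulr0.
Qed.

Lemma antipodeE (S : seq nat -> eltSS) n u x : is_antipode S -> is_perm n u ->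
  coefSS (S u) x = if is_perm n x then antipode_coef u x else 0.
Proof.
move=> hS; have [k] := ubnP n; elim: k n u x => // k IH n u x lk hu.
have su := is_perm_size hu.
have huu : is_perm (size u) u by rewrite su.
have [_ /(_ x)] := hS u huu.
rewrite coefSS_flatten big_map su /= big_cons take0 drop0 (st_id hu) [st [::]]/= coefSS_mulFF.
have -> : \sum_(b <- S u) b.1 * (count_mem x (prodF [::] b.2))%:R = coefSS (S u) x.
  rewrite /coefSS [RHS]big_mkcond; apply: eq_bigr => b _; rewrite count_prodF_nil.
  by case: eqP; rewrite ?mulr1 ?mulr0.
have [n0|n0] := posnP n.
  rewrite n0 big_nil addr0 => ->; rewrite /antipode_coef /unitSS su n0 eqxx.
  rewrite /coefSS big_cons big_nil addr0 /is_perm; case: (x) => [|a s] //.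
  by case: (boolP (perm_eq _ _)) => // /perm_size.
have -> : coefSS (unitSS u) x = 0.
  by rewrite /unitSS su -[n == 0%N]negbK -lt0n n0 /coefSS big_nil.
move/eqP; rewrite addr_eq0 => /eqP ->.
have step p : p \in iota 1 n ->
  coefSS (mulSS (FF (st (take p u))) (S (st (drop p u)))) x =
  if is_perm n x then (sorted ltn (permcomp (pinv x) (st (take p u))))%:R *
                      antipode_coef (st (drop p u)) (upper p x) else 0.
  rewrite mem_iota => hp.
  have hT := st_take_perm hu (ltac:(lia) : (p <= n)%N).
  have hD := st_drop_perm p hu.
  have IHp y := IH (n - p)%N (st (drop p u)) y (ltac:(lia) : (n - p < k)%N) hD.
  have pnp : (p + (n - p))%N = n by lia.
  rewrite coefSS_mulFF (sum_coefSS (s := allperms (n - p))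
    (fun w => (count_mem x (prodF (st (take p u)) w))%:R)) ?allperms_uniq //; last first.
    by move=> y; rewrite mem_allperms IHp => /negbTE ->.
  rewrite big_seq (eq_bigr (fun w => if is_perm n x && (w == upper p x) then
     (sorted ltn (permcomp (pinv x) (st (take p u))))%:R * antipode_coef (st (drop p u)) w
     else 0)); last first.
    move=> w; rewrite mem_allperms => hw.
    rewrite IHp hw (count_prodF x hT hw) pnp.
    case: (boolP (is_perm n x)) => hx /=; last by rewrite mulr0.
    rewrite (shuffle_okE _ hT hw) ?pnp //.
    by case: (w == _); rewrite ?andbT ?andbF ?mulr0 // mulrC.
  rewrite -big_seq; case: (boolP (is_perm n x)) => hx /=; last by rewrite big1.
  have hU : is_perm (n - p) (upper p x) by apply: upper_perm; rewrite pnp.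
  rewrite (bigD1_seq (upper p x)) ?mem_allperms ?allperms_uniq //= eqxx.
  by rewrite big1 ?addr0 // => w /negbTE ->.
rewrite big_seq (eq_bigr _ step) -big_seq; case: (boolP (is_perm n x)) => hx.
  by rewrite (antipode_coef_rec n0 hu hx).
by rewrite big1 ?oppr0.
Qed.

Lemma sum_antipode_coef n u w : (0 < n)%N -> is_perm n u ->
  \sum_(x <- allperms n | weak_le x w) antipode_coef u x =
  \sum_(z <- allperms n) \sum_(J <- subseqs (iota 1 n.-1) | subsetb (Des z) J)
    (-1) ^+ (size J).+1 * (weak_le (permcomp (vJ u J) (pinv z)) w)%:R.
Proof.
move=> n0 hu; rewrite /antipode_coef (is_perm_size hu) -[n == 0%N]negbK -lt0n n0 /=.
rewrite exchange_big /= [RHS](exchange_big_dep predT) //= big_seq [RHS]big_seq.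
apply: eq_bigr => J /cutset_subseqs cJ; have hy := vJ_perm hu n0 cJ.
rewrite -(perm_big _ (perm_permcomp_pinv hy)) /= big_map big_mkcond [RHS]big_mkcond.
rewrite big_seq [RHS]big_seq; apply: eq_bigr => z; rewrite mem_allperms => hz.
rewrite (pinv_permcompK hy hz).
by case: weak_le; case: subsetb; rewrite ?mulr0.
Qed.

Lemma sum_mobius_block n v w z J : (0 < n)%N -> is_perm n v -> is_perm n w -> is_perm n z ->
  cutset n J -> subsetb (Des z) J ->
  \sum_(u <- allperms n | weak_le v u)
     mobius v u * (weak_le (permcomp (vJ u J) (pinv z)) w)%:R =
  (block_fit v w z J)%:R.
Proof.
move=> n0 hv hw hz cJ dz; rewrite /block_fit dz /=.
have hg := block_max_perm J hz hw.
rewrite big_seq_cond (eq_bigr (fun u => if weak_le (pinv z) w then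
   (if weak_le u (block_max J z w) then mobius v u else 0) else 0)); last first.
  move=> u /andP []; rewrite mem_allperms => hu _.
  rewrite (weak_le_vJ hu hz hw n0 cJ dz).
  by case: weak_le; case: weak_le; rewrite ?mulr1 ?mulr0.
rewrite -big_seq_cond; case: (weak_le (pinv z) w); last by rewrite big1.
by rewrite -big_mkcondr (mobius_sum hv hg).
Qed.

End Antipode.

Theorem mainTheorem9 (S : seq nat -> eltSS) (hS : is_antipode S)
  (n : nat) (hn : (1 <= n)%N) (v : seq nat) (hv : is_perm n v) :
  eqElt (extSS S (MM v))
      (scaleSS ((-1) ^+ (size (GDes v)).+1)
         (flatten [seq scaleSS (kappa v w)%:R (MM w) | w <- allperms n])).
Proof.
have coefL x : coefSS (extSS S (MM v)) x =
    if is_perm n x then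
      \sum_(u <- allperms n | weak_le v u) mobius v u * antipode_coef u x else 0.
  rewrite coefSS_flatten !big_map big_filter (is_perm_size hv) big_seq_cond.
  rewrite (eq_bigr (fun u => if is_perm n x then mobius v u * antipode_coef u x else 0)).
    by rewrite -big_seq_cond; case: ifP => // _; rewrite big1.
  move=> u /andP []; rewrite mem_allperms => hu _.
  by rewrite coefSS_scale (antipodeE x hS hu) /=; case: ifP; rewrite ?mulr0.
have coefR x : coefSS (scaleSS ((-1) ^+ (size (GDes v)).+1)
         (flatten [seq scaleSS (kappa v w)%:R (MM w) | w <- allperms n])) x =
    if is_perm n x then
      \sum_(w <- allperms n) (if weak_le w x then
        (-1) ^+ (size (GDes v)).+1 * (kappa v w)%:R * mobius w x else 0) else 0.
  rewrite coefSS_scale coefSS_flatten big_map mulr_sumr big_seq.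
  rewrite (eq_bigr (fun w => if is_perm n x && weak_le w x then
        (-1) ^+ (size (GDes v)).+1 * (kappa v w)%:R * mobius w x else 0)).
    by rewrite -big_seq; case: ifP => // _; rewrite big1.
  move=> w; rewrite mem_allperms => hw.
  by rewrite coefSS_scale (coefSS_MM x hw) -mulrA; case: ifP; rewrite ?mulr0.
move=> x; rewrite coefL coefR; case: ifP => // hx.
move: x hx {coefL coefR}; apply: weak_le_triangular => w hw.
transitivity ((-1) ^+ (size (GDes v)).+1 * (kappa v w)%:R : rat).
  rewrite exchange_big /=.
  under eq_bigr => u _ do rewrite -mulr_sumr.
  rewrite big_seq_cond.
  under eq_bigr => u /andP [].
    rewrite mem_allperms => hu _; rewrite (sum_antipode_coef w hn hu) mulr_sumr.
    over.
  rewrite -big_seq_cond exchange_big /=.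
  rewrite /kappa (is_perm_size hv) -sum1_count natr_sum mulr_sumr [RHS]big_mkcond.
  rewrite big_seq [RHS]big_seq; apply: eq_bigr => z; rewrite mem_allperms => hz.
  under eq_bigr => u _ do rewrite mulr_sumr.
  rewrite exchange_big /= big_seq_cond.
  rewrite (eq_bigr (fun J => if block_fit v w z J then - (-1) ^+ size J else 0)).
    rewrite -big_seq_cond -big_mkcondr.
    rewrite (eq_bigl (block_fit v w z)); last first.
      by move=> J; rewrite /block_fit andbA andbb.
    rewrite sumrN (sum_block_fit hn hv hw hz) exprS mulN1r.
    by case: (inC _ _ _ _); rewrite ?mulr1 ?mulr0 ?oppr0.
  move=> J /andP [/cutset_subseqs cJ dz].
  under eq_bigr => u _ do rewrite mulrCA.
  rewrite -mulr_sumr (sum_mobius_block hn hv hw hz cJ dz) exprS mulN1r.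
  by case: block_fit; rewrite ?mulr1 ?mulr0.
under [RHS]eq_bigr do rewrite big_mkcond.
rewrite exchange_big /= (bigD1_seq w) ?mem_allperms ?allperms_uniq //=.
have inner y : is_perm n y -> \sum_(x <- allperms n | weak_le x w)
    (if weak_le y x then (-1) ^+ (size (GDes v)).+1 * (kappa v y)%:R * mobius y x else 0) =
    (-1) ^+ (size (GDes v)).+1 * (kappa v y)%:R * (y == w)%:R.
  move=> hy; rewrite -(mobius_sum hy hw) mulr_sumr -big_mkcondr.
  by apply: eq_bigl => x; rewrite andbC.
rewrite inner // eqxx mulr1 big_seq_cond big1 ?addr0 // => y.
by rewrite mem_allperms => /andP [hy nyw]; rewrite inner // (negbTE nyw) mulr0.
Qed.
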